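(* Let $A$ be drawn from a $G(w)$ distribution (with or without self-loops) satisfying $(\epsilon,\delta)$-concentration for $G(w)$ graphs, let $\beta>0$, $b\in\mathbb{R}^n_{\ge0}$, and let $C\ge\frac{256\|b\|^2}{(\epsilon\beta\tilde d)^2}$. Then with probability at least $1-\delta$, if the spectral radius of $A$ is less than $1/\beta$, $$\frac{W\!\left(\sqrt C\cdot\frac{w}{\|w\|}\right)}{W(y^* )}\ge1-\epsilon,$$ where $y^*$ is the optimal intervention of budget $C$ in the network game on $A$.
   Context: $G(w)$ graph: for a vector $w\in\mathbb{R}^n$ with $w_1\ge w_2\ge\dots\ge w_n>0$ and $w_1\le\sqrt{\sum_kw_k}$, each edge $\{i,j\}$ (including $i=j$ unless self-loops are removed) is included independently with probability $\bar A_{ij}=\frac{w_iw_j}{\sum_kw_k}$; removing self-loops means setting $\bar A_{ii}=0$. The second-order average degree is $\tilde d=\frac{\sum_iw_i^2}{\sum_iw_i}$. A $G(w)$ distribution satisfies $(\epsilon,\delta)$-concentration for $G(w)$ graphs ($\epsilon,\delta\in(0,1)$) if (1) $\frac49\log(2n/\delta)\le w_1\le\frac{\|w\|}{6}$ and (2) $\tilde d\ge\frac{256(\sqrt{4w_1\log(2n/\delta)}+1)}{\epsilon^2}$. Network game: agent $i$ has utility $u_i(a)=b_ia_i-\tfrac12a_i^2+\beta\sum_jA_{ij}a_ia_j$; $M=I-\beta A$; an intervention $y$ replaces $b$ by $b+y$ and yields equilibrium welfare $W(y)=\tfrac12\|M^{-1}(b+y)\|^2$; the optimal intervention of budget $C$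 is $y^*\in\arg\max_{\|x\|=\sqrt C}W(x)$. *)

(* Defs.v *)
From HB Require Import structures.
From mathcomp Require Import all_boot all_order all_algebra.
From mathcomp Require Import complex.
From mathcomp Require Import boolp reals exp.

Set Implicit Arguments.
Unset Strict Implicit.
Unset Printing Implicit Defensive.

Import Order.TTheory GRing.Theory Num.Theory.
Local Open Scope ring_scope.

Section Defs.
Variable R : realType.

Definition norm2 n (v : 'cV[R]_n) : R := Num.sqrt (\sum_i v i 0 ^+ 2).

Definition vec n (w : 'I_n -> R) : 'cV[R]_n := \col_i w i.

Definition wsum n (w : 'I_n -> R) : R := \sum_i w i.

Definition wmax n (w : 'I_n -> R) : R := \big[Num.max/0]_i w i.

Definition dtilde n (w : 'I_n -> R) : R := (\sum_i w i ^+ 2) / wsum w.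

Definition Abar n (loops : bool) (w : 'I_n -> R) (i j : 'I_n) : R :=
  if (i == j) && ~~ loops then 0 else w i * w j / wsum w.

(* Sample space: edge indicators e (i,j); the graph is the symmetric 0/1
   matrix.  The mass is zero unless e is symmetric; independent edges
   {i,j}, i <= j (including i = j). *)
Definition graph_mass n (loops : bool) (w : 'I_n -> R)
    (e : {ffun 'I_n * 'I_n -> bool}) : R :=
  ([forall i, forall j, e (i, j) == e (j, i)])%:R *
  \prod_(p : 'I_n * 'I_n | (p.1 <= p.2)%N)
     (if e p then Abar loops w p.1 p.2 else 1 - Abar loops w p.1 p.2).

Definition adj n (e : {ffun 'I_n * 'I_n -> bool}) : 'M[R]_n :=
  \matrix_(i, j) (e (i, j))%:R.

Definition Gw_prob n (loops : bool) (w : 'I_n -> R)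
    (P : 'M[R]_n -> Prop) : R :=
  \sum_(e | `[< P (adj e) >]) graph_mass loops w e.

Definition spectral_radius_lt n (A : 'M[R]_n) (r : R) : Prop :=
  forall z : R[i], eigenvalue (map_mx (fun x : R => (x%:C)%C) A) z -> `|z| < (r%:C)%C.

Definition welfare n (beta : R) (A : 'M[R]_n) (b y : 'cV[R]_n) : R :=
  2^-1 * norm2 (invmx (1%:M - beta *: A) *m (b + y)) ^+ 2.

Definition optimal_intervention n (beta : R) (A : 'M[R]_n) (b : 'cV[R]_n)
    (C : R) (y : 'cV[R]_n) : Prop :=
  norm2 y = Num.sqrt C /\
  forall x : 'cV[R]_n, norm2 x = Num.sqrt C -> welfare beta A b x <= welfare beta A b y.

Definition concentration n (w : 'I_n -> R) (eps delta : R) : Prop :=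
  4 / 9 * ln (2 * n%:R / delta) <= wmax w /\
  wmax w <= norm2 (vec w) / 6 /\
  dtilde w >= 256 * (Num.sqrt (4 * wmax w * ln (2 * n%:R / delta)) + 1) / eps ^+ 2.

End Defs.

(* Main.v *)
(** Up to the diagonal, the mean of the adjacency matrix [A] is the rank one matrix [w w^T / S], with
    [S] the sum of the weights, whose only nonzero eigenvalue is [dtilde w].  If [A] is within
    [eps * dtilde w / 50] of it as a quadratic form, the top eigenvector [u] of [A] is almost parallel
    to [w]; as [(1 - beta A)^-1] attains its operator norm at [u], intervening along [w] is almost
    optimal, the budget being large enough to make [b] negligible.

    The noise [X = A - E A] is controlled by its trace moments.  It is a sum over edges [k] of centred
    Bernoulli variables times fixed symmetric matrices [H k], so resampling one edge at a time gives
    [E tr X^(2p) <= p E tr (V X^(2p-2))], where [V] is the diagonal matrix of (degree + mean degree).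
    This uses the trace inequality
    [2 sum_(i+j = 2p-2) tr (H X^i H Y^j) <= (2p-1) (tr (H^2 X^(2p-2)) + tr (H^2 Y^(2p-2)))]
    for symmetric matrices.  Young's inequality then yields [E tr X^(2p) <= p^p E tr V^p], the moments
    of the degrees are bounded by a scalar Chernoff argument, and Markov's inequality with [p] about
    [ln (2n / delta)] concludes. *)
Require Import Defs.
From HB Require Import structures.
From mathcomp Require Import all_boot all_order all_algebra.
From mathcomp Require Import spectral sesquilinear.
From mathcomp Require Import complex.
From mathcomp Require Import boolp reals sequences exp.
From mathcomp Require Import ring lra.
Import Order.TTheory GRing.Theory Num.Theory.
Local Open Scope ring_scope.
Set Implicit Arguments.
Unset Strict Implicit.

(** * Spectral decomposition of real symmetric matrices, through complex scalars *)

Lemma mulmx_conj (F : pzRingType) n (U V D E : 'M[F]_n) : U *m V = 1%:M ->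
  V *m D *m U *m (V *m E *m U) = V *m (D *m E) *m U.
Proof. by move=> UV; rewrite !mulmxA -[V *m D *m U *m V]mulmxA UV mulmx1. Qed.

Lemma mxtrace_conj2 (F : comPzRingType) n (H A B C D E G : 'M[F]_n) :
  \tr (H *m (A *m D *m B) *m H *m (C *m E *m G)) =
  \tr (G *m H *m A *m D *m (B *m H *m C) *m E).
Proof. by rewrite !mulmxA mxtrace_mulC !mulmxA. Qed.

Section Spectral.
Local Open Scope sesquilinear_scope.
Variable R : realType.
Local Notation toC := (real_complex R).

Lemma conjC_toC (x : R) : Num.conj (toC x) = toC x.
Proof. by rewrite conj_Creal // complex_real. Qed.

Lemma map_toC_conjC m n (A : 'M[R]_(m, n)) :
  map_mx Num.conj (map_mx toC A) = map_mx toC A.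
Proof. by apply/matrixP => i j; rewrite !mxE conjC_toC. Qed.

Lemma mul_conjC_toC (z : R[i]) :
  Num.conj z * z = toC (complex.Re z ^+ 2 + complex.Im z ^+ 2).
Proof. by rewrite mulrC -normCK complex.normc_def -rmorphXn sqr_sqrtr ?addr_ge0 ?sqr_ge0. Qed.

(** Over [R[i]] a real symmetric matrix is Hermitian, so the spectral theorem applies and the
    eigenvalues are real. One [U] serves all powers. *)
Lemma symmetric_spectral n (X : 'M[R]_n) : X^T = X ->
  exists (U : 'M[R[i]]_n) (lam : 'I_n -> R),
    U *m U^t* = 1%:M /\
    forall k, map_mx toC (X ^+ k) = U^t* *m diag_mx (\row_i toC (lam i ^+ k)) *m U.
Proof.
move=> Xsym; pose XC := map_mx toC X.
have Xherm : XC \is hermsymmx.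
  apply/is_hermitianmxP; rewrite expr0 scale1r.
  by rewrite /XC map_trmx Xsym map_toC_conjC.
have /hermitian_normalmx/orthomx_spectralP XE := Xherm.
have Ureal := hermitian_spectral_diag_real Xherm.
set U := spectralmx XC in XE.
have Uun : U \is unitarymx by exact: spectral_unitarymx.
rewrite invmx_unitary // in XE.
have UU : U *m U^t* = 1%:M by apply/unitarymxP.
exists U, (fun i => complex.Re (spectral_diag XC 0 i)); split => // k.
have DE : spectral_diag XC = \row_i toC (complex.Re (spectral_diag XC 0 i)).
  apply/rowP => i; rewrite !mxE.
  by have /mxOverP /(_ 0 i) /complex_realP [x ->] := Ureal.
elim: k => [|k IHk].
  rewrite expr0 /= map_mx1.
  have -> : diag_mx (\row_i toC (complex.Re (spectral_diag XC 0 i) ^+ 0)) = 1%:M.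
    by apply/matrixP => i j; rewrite !mxE expr0.
  by rewrite mulmx1; apply/esym/mulmx1C.
rewrite exprSr [map_mx _ _]map_mxM IHk -/XC [X in _ *m X]XE (mulmx_conj _ _ UU).
apply: (congr1 (fun D => U^t* *m D *m U)).
rewrite mul_diag_mx; apply/matrixP => i j; rewrite [in LHS]DE !mxE.
by case: eqP => [->|]; rewrite ?mulr0n ?mulr0 // !mulr1n exprSr rmorphM.
Qed.

(** The squared moduli of the entries of [K] act as nonnegative weights, so scalar inequalities on
    [a i] and [b j] pass to traces. *)
Lemma mxtrace_sandwich (m n : nat) (K : 'M[R[i]]_(m, n)) (a : 'I_m -> R) (b : 'I_n -> R) :
  \tr (K^t* *m diag_mx (\row_i toC (a i)) *m K *m diag_mx (\row_i toC (b i))) =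
  toC (\sum_i \sum_j (complex.Re (K i j) ^+ 2 + complex.Im (K i j) ^+ 2) * (a i * b j)).
Proof.
rewrite exchange_big /mxtrace rmorph_sum; apply: eq_bigr => j _.
rewrite mul_mx_diag !mxE rmorph_sum big_distrl; apply: eq_bigr => i _ /=.
rewrite mul_mx_diag !mxE rmorphM /= -mul_conjC_toC rmorphM /=; ring.
Qed.

(** The weights [c i] are the squared moduli of the coordinates of [x] in the eigenbasis; being
    independent of [k], they form the spectral measure of [x]. *)
Lemma spectral_mxtrace n (X : 'M[R]_n) : X^T = X ->
  exists lam : 'I_n -> R,
    (forall k, \tr (X ^+ k) = \sum_i lam i ^+ k) /\
    (forall i, eigenvalue (map_mx toC X) (toC (lam i))) /\
    (forall x : 'cV[R]_n, exists2 c : 'I_n -> R, (forall i, 0 <= c i) &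
        forall k, (x^T *m (X ^+ k) *m x) 0 0 = \sum_i c i * lam i ^+ k).
Proof.
move=> /symmetric_spectral [U [lam [UU XE]]]; exists lam; split; last split.
- move=> k; apply: (@complexI R); rewrite -trace_map_mx XE.
  rewrite mxtrace_mulC mulmxA UU mul1mx mxtrace_diag rmorph_sum.
  by apply: eq_bigr => i _; rewrite mxE.
- move=> i; apply/eigenvalueP; exists (row i U).
    have := XE 1; rewrite expr1 => ->; rewrite -row_mul !mulmxA UU mul1mx.
    by rewrite mul_diag_mx; apply/rowP => j; rewrite !mxE expr1.
  apply/eqP => U0; have := congr1 (fun M : 'M_n => M i i) UU.
  rewrite !mxE eqxx big1 => [/esym/eqP|j _]; first by rewrite oner_eq0.
  by have /rowP/(_ j) := U0; rewrite !mxE => ->; rewrite mul0r.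
move=> x; pose K := U *m map_mx toC x.
exists (fun i => complex.Re (K i 0) ^+ 2 + complex.Im (K i 0) ^+ 2) => [i|k].
  by rewrite addr_ge0 ?sqr_ge0.
have := mxtrace_sandwich K (fun i => lam i ^+ k) (fun=> 1).
have -> : K^t* = map_mx toC x^T *m U^t*.
  by rewrite trmx_mul map_mxM /= map_trmx map_toC_conjC.
have -> : diag_mx (\row__ toC 1) = 1%:M :> 'M_1.
  by apply/matrixP => i j; rewrite !mxE.
rewrite mulmx1 /K !mulmxA -[_ *m U^t* *m _ *m _]mulmxA -[_ *m U^t* *m _]mulmxA.
rewrite [U^t* *m _]mulmxA -XE -!map_mxM trace_map_mx => /complexI.
rewrite [\tr _]big_ord1 => ->.
by apply: eq_bigr => i _; rewrite big_ord1 mulr1.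
Qed.

(** [X] and [Y] need not commute: [g i j] is the squared modulus of the entry of [H] between the
    [i]-th eigenvector of [X] and the [j]-th of [Y]. *)
Lemma spectral_mxtrace2 n (H X Y : 'M[R]_n) : H^T = H -> X^T = X -> Y^T = Y ->
  exists (lam mu : 'I_n -> R) (g : 'I_n -> 'I_n -> R), (forall i j, 0 <= g i j) /\
    forall k l, \tr (H *m X ^+ k *m H *m Y ^+ l) =
      \sum_i \sum_j g i j * (lam i ^+ k * mu j ^+ l).
Proof.
move=> Hsym /symmetric_spectral [U [lam [UU XE]]] /symmetric_spectral [V [mu [VV YE]]].
pose K := U *m map_mx toC H *m V^t*.
exists lam, mu, (fun i j => complex.Re (K i j) ^+ 2 + complex.Im (K i j) ^+ 2).
split=> [i j|k l]; first by rewrite addr_ge0 ?sqr_ge0.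
have := mxtrace_sandwich K (fun i => lam i ^+ k) (fun j => mu j ^+ l).
have -> : K^t* = V *m map_mx toC H *m U^t*.
  have HC : (map_mx toC H)^t* = map_mx toC H by rewrite map_trmx Hsym map_toC_conjC.
  by rewrite trmx_mul map_mxM trmx_mul map_mxM /= HC trmxCK mulmxA.
move=> E; apply: (@complexI R); rewrite -E -trace_map_mx !map_mxM XE YE /K.
exact: mxtrace_conj2.
Qed.
End Spectral.

(** * Trace inequalities for symmetric matrices *)

Section TraceInequality.
Variable R : realType.

(** Even total degree allows passing to absolute values, where the gap is
    [(a ^+ i - b ^+ i) * (a ^+ j - b ^+ j)], a product of factors of the same sign. *)
Lemma mulX_le_pair (x y : R) i j : ~~ odd (i + j) ->
  x ^+ i * y ^+ j + x ^+ j * y ^+ i <= x ^+ (i + j) + y ^+ (i + j).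
Proof.
move=> even_ij.
have leX a b : x ^+ a * y ^+ b <= `|x| ^+ a * `|y| ^+ b.
  by rewrite -!normrX -normrM ler_norm.
apply: (le_trans (lerD (leX i j) (leX j i))).
have <- : `|x| ^+ (i + j) = x ^+ (i + j).
  by rewrite -normrX ger0_norm ?real_exprn_even_ge0 ?num_real.
have <- : `|y| ^+ (i + j) = y ^+ (i + j).
  by rewrite -normrX ger0_norm ?real_exprn_even_ge0 ?num_real.
move: `|x| `|y| (normr_ge0 x) (normr_ge0 y) => a b a0 b0; rewrite !exprD.
suff : 0 <= (a ^+ i - b ^+ i) * (a ^+ j - b ^+ j) by nra.
case: (leP a b) => [ab|/ltW ba].
  by apply: mulr_le0; rewrite subr_le0 lerXn2r.
by apply: mulr_ge0; rewrite subr_ge0 lerXn2r.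
Qed.

Lemma sum_mulX_le (x y : R) m :
  \sum_(i < m.*2.+1) x ^+ (m.*2 - i) * y ^+ i <=
    m.*2.+1%:R / 2 * (x ^+ m.*2 + y ^+ m.*2).
Proof.
set S := \sum_(i < _) _.
suff : S + S <= m.*2.+1%:R * (x ^+ m.*2 + y ^+ m.*2) by lra.
(* Reversing one of the two copies pairs the exponents [(m.*2 - i, i)] with [(i, m.*2 - i)]. *)
rewrite {2}/S (reindex_inj rev_ord_inj) -big_split /=.
rewrite -[m.*2.+1 in leRHS](card_ord m.*2.+1) mulr_natl -sumr_const.
apply: ler_sum => i _; have le_i : (i <= m.*2)%N by rewrite -ltnS.
rewrite subSS subKn // -[in leRHS](subnK le_i); apply: mulX_le_pair.
by rewrite subnK // odd_double.
Qed.

Lemma subrXX_noncomm (S : pzRingType) (x y : S) n :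
  x ^+ n - y ^+ n = \sum_(i < n) x ^+ (n.-1 - i) * (x - y) * y ^+ i.
Proof.
elim: n => [|n IHn]; first by rewrite big_ord0 subrr.
rewrite big_ord_recr /= subnn mul1r.
rewrite (eq_bigr (fun i : 'I_n => x * (x ^+ (n.-1 - i) * (x - y) * y ^+ i))).
  rewrite -big_distrr -IHn /= mulrBr mulrBl -!exprS addrA.
  by congr (_ - _); rewrite subrK.
move=> i _; rewrite !mulrA -exprS; congr (_ ^+ _ * _ * _).
by case: n i {IHn} => [[]//|n] i /=; rewrite -subSn // -ltnS.
Qed.

(** Telescoping leaves one [H] between a power of [X] and a power of [Y]. In the joint spectral
    expansion the claim holds weight by weight, by [sum_mulX_le]. *)
Lemma mxtrace_subX_le n (X Y : 'M[R]_n) (H := X - Y) m : X^T = X -> Y^T = Y ->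
  \tr (H *m (X ^+ m.*2.+1 - Y ^+ m.*2.+1)) <=
    m.*2.+1%:R / 2 * (\tr (H *m H *m X ^+ m.*2) + \tr (H *m H *m Y ^+ m.*2)).
Proof.
move=> Xsym Ysym; have Hsym : H^T = H by rewrite linearB /= Xsym Ysym.
have [lam [mu [g [g0 trE]]]] := spectral_mxtrace2 Hsym Xsym Ysym.
have -> : \tr (H *m H *m X ^+ m.*2) = \tr (H *m X ^+ m.*2 *m H *m Y ^+ 0).
  by rewrite expr0 mulmx1 -mulmxA mxtrace_mulC.
have -> : \tr (H *m H *m Y ^+ m.*2) = \tr (H *m X ^+ 0 *m H *m Y ^+ m.*2).
  by rewrite expr0 mulmx1.
rewrite subrXX_noncomm linear_sum raddf_sum /=.
under eq_bigr => i _ do rewrite !mulmxA trE.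
rewrite !trE exchange_big /= -big_split big_distrr; apply: ler_sum => i _ /=.
rewrite exchange_big /= -big_split big_distrr; apply: ler_sum => j _ /=.
rewrite -big_distrr /= !expr0 mulr1 mul1r -mulrDr mulrCA.
by apply: ler_wpM2l => //; apply: sum_mulX_le.
Qed.

(** Weighted AM-GM by induction: [y] times the previous case is added to
    [0 <= (a - y) * (a ^+ m.+1 - y ^+ m.+1)]. *)
Lemma young_expr (a y : R) m : 0 <= a -> 0 <= y ->
  m.+1%:R * (a * y ^+ m) <= a ^+ m.+1 + m%:R * y ^+ m.+1.
Proof.
move=> a0 y0; elim: m => [|m IHm]; first by rewrite expr0 expr1 !mul0r; lra.
have /(ler_wpM2l y0) := IHm.
have : 0 <= (a - y) * (a ^+ m.+1 - y ^+ m.+1).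
  case: (leP a y) => [ay|/ltW ya].
    by apply: mulr_le0; rewrite subr_le0 ?lerXn2r.
  by apply: mulr_ge0; rewrite subr_ge0 ?lerXn2r.
rewrite -!natr1 !exprS; set A := a ^+ m; set Y := y ^+ m; nra.
Qed.

(** The trace is the squared Frobenius norm of [A *m X ^+ m]. *)
Lemma mxtrace_sqrX_even_ge0 n (A X : 'M[R]_n) m : A^T = A -> X^T = X ->
  0 <= \tr (A *m A *m X ^+ m.*2).
Proof.
move=> Asym Xsym; have Xm : (X ^+ m)^T = X ^+ m.
  elim: m => [|m IHm]; first by rewrite expr0 trmx1.
  by rewrite {1}exprS [LHS]trmx_mul IHm Xsym exprSr.
have -> : \tr (A *m A *m X ^+ m.*2) = \tr ((A *m X ^+ m)^T *m (A *m X ^+ m)).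
  rewrite trmx_mul Asym Xm -addnn exprD -[X ^+ m * _]/(_ *m _).
  by rewrite [RHS]mxtrace_mulC [in RHS]mulmxA [RHS]mxtrace_mulC !mulmxA.
apply: sumr_ge0 => i _; rewrite mxE.
by apply: sumr_ge0 => j _; rewrite mxE -expr2 sqr_ge0.
Qed.

(** The spectral measure of the [i]-th basis vector has total mass 1, so [young_expr] with
    [y = lam j ^+ 2] can be integrated against it. *)
Lemma diag_expr_young n (X : 'M[R]_n) (a : R) m (i : 'I_n) : X^T = X -> 0 <= a ->
  m.+1%:R * (a * (X ^+ m.*2) i i) <= a ^+ m.+1 + m%:R * (X ^+ m.+1.*2) i i.
Proof.
move=> Xsym a0; have [lam [_ [_ /(_ (delta_mx i 0)) [c c0 cE]]]] := spectral_mxtrace Xsym.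
have XE k : (X ^+ k) i i = \sum_j c j * lam j ^+ k.
  by rewrite -cE trmx_delta -rowE -colE !mxE.
have c1 : \sum_j c j = 1.
  have := XE 0; rewrite expr0 mxE eqxx mulr1n => ->.
  by apply: eq_bigr => j _; rewrite expr0 mulr1.
have -> : a ^+ m.+1 = \sum_j c j * a ^+ m.+1 by rewrite -big_distrl /= c1 mul1r.
rewrite !XE !big_distrr -big_split /=.
apply: ler_sum => j _; have := young_expr m a0 (sqr_ge0 (lam j)).
rewrite -!exprM !mul2n => /(ler_wpM2l (c0 j)); rewrite mulrDr.
by set u := lam j ^+ _; set v := lam j ^+ _; nra.
Qed.

End TraceInequality.

(** * Product Bernoulli measures and resampling of one coordinate *)

Section BernoulliCube.
Variables (R : realType) (K : finType) (q : K -> R).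
Implicit Types (g : {ffun K -> bool}) (F : {ffun K -> bool} -> R) (k : K).

Definition bern_weight k (b : bool) : R := if b then q k else 1 - q k.

Definition bern_mass g : R := \prod_k bern_weight k (g k).

Definition bern_expect F : R := \sum_g bern_mass g * F g.

Definition set_edge k (b : bool) g : {ffun K -> bool} :=
  [ffun j => if j == k then b else g j].

Lemma bern_expectD F1 F2 :
  bern_expect (fun g => F1 g + F2 g) = bern_expect F1 + bern_expect F2.
Proof. by rewrite -big_split; apply: eq_bigr => g _; rewrite mulrDr. Qed.

Lemma bern_expectZ c F : bern_expect (fun g => c * F g) = c * bern_expect F.
Proof. by rewrite /bern_expect big_distrr; apply: eq_bigr => g _ /=; rewrite mulrCA. Qed.

Lemma bern_expect_sum (I : finType) (F : I -> {ffun K -> bool} -> R) :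
  bern_expect (fun g => \sum_i F i g) = \sum_i bern_expect (F i).
Proof.
by rewrite exchange_big; apply: eq_bigr => g _; rewrite big_distrr.
Qed.

Lemma eq_bern_expect F1 F2 : F1 =1 F2 -> bern_expect F1 = bern_expect F2.
Proof. by move=> eqF; apply: eq_bigr => g _; rewrite eqF. Qed.

Lemma bern_expect_prod (f : K -> bool -> R) :
  bern_expect (fun g => \prod_k f k (g k)) =
    \prod_k (q k * f k true + (1 - q k) * f k false).
Proof.
under [RHS]eq_bigr => k _.
  have -> : q k * f k true + (1 - q k) * f k false =
    \sum_(b : bool) bern_weight k b * f k b by rewrite big_bool.
  over.
rewrite (bigA_distr_bigA (fun k b => bern_weight k b * f k b)).
by apply: eq_bigr => g _; rewrite -big_split.
Qed.

Lemma bern_mass_sum1 : \sum_g bern_mass g = 1.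
Proof.
have := bern_expect_prod (fun _ _ => 1).
rewrite [RHS]big1 => [|k _]; last by ring.
move=> <-; apply: eq_bigr => g _; rewrite big1 ?mulr1 //.
Qed.

Lemma sum_set_edge k F :
  \sum_g F g = \sum_(g : {ffun K -> bool} | g k) (F g + F (set_edge k false g)).
Proof.
rewrite (bigID (fun g : {ffun K -> bool} => g k)) big_split /=; congr (_ + _).
rewrite (reindex_onto (set_edge k false) (set_edge k true)) /=.
  apply: eq_bigl => g; rewrite ffunE eqxx /=.
  apply/eqP/idP => [<-|gk]; first by rewrite ffunE eqxx.
  by apply/ffunP => j; rewrite !ffunE; case: eqP => [->|].
move=> g gk; apply/ffunP => j; rewrite !ffunE; case: eqP => [->|//].
by rewrite (negbTE gk).
Qed.

Lemma bern_expect_set_edge k F :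
  bern_expect F = bern_expect (fun g =>
    q k * F (set_edge k true g) + (1 - q k) * F (set_edge k false g)).
Proof.
rewrite /bern_expect !(sum_set_edge k); apply: eq_bigr => g gk.
have setT : set_edge k true g = g.
  by apply/ffunP => j; rewrite !ffunE; case: eqP => [->|].
have setTF : set_edge k true (set_edge k false g) = g.
  by apply/ffunP => j; rewrite !ffunE; case: eqP => [->|].
have setFF : set_edge k false (set_edge k false g) = set_edge k false g.
  by apply/ffunP => j; rewrite !ffunE; case: eqP.
have massE b : bern_mass (set_edge k b g) =
    bern_weight k b * \prod_(i | i != k) bern_weight i (g i).
  rewrite /bern_mass (bigD1 k) //= ffunE eqxx; congr (_ * _).
  by apply: eq_bigr => j /negbTE jk; rewrite ffunE jk.
have massg := massE true; rewrite setT /= in massg.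
by rewrite setTF setFF setT massg massE /bern_weight; ring.
Qed.

(** Discrete integration by parts: the centred factor is [1 - q k] with probability [q k] and
    [- q k] with probability [1 - q k]. *)
Lemma bern_stein k F :
  bern_expect (fun g => ((g k)%:R - q k) * F g) =
  bern_expect (fun g =>
    q k * (1 - q k) * (F (set_edge k true g) - F (set_edge k false g))).
Proof.
rewrite (bern_expect_set_edge k); apply: eq_bern_expect => g.
by rewrite !ffunE eqxx mulr1n mulr0n; ring.
Qed.

(** Serves to return from the two resampled configurations to [g] itself after [bern_stein]. *)
Lemma bern_expect_flip k F :
  bern_expect (fun g => q k * (1 - q k) * (F (set_edge k true g) + F (set_edge k false g))) =
  bern_expect (fun g => ((g k)%:R * (1 - q k) + (1 - (g k)%:R) * q k) * F g).
Proof.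
rewrite [RHS](bern_expect_set_edge k); apply: eq_bern_expect => g.
by rewrite !ffunE eqxx mulr1n mulr0n; ring.
Qed.

Hypothesis q01 : forall k, 0 <= q k <= 1.

Lemma bern_mass_ge0 g : 0 <= bern_mass g.
Proof.
apply: prodr_ge0 => k _; rewrite /bern_weight.
by have /andP[] := q01 k; case: (g k) => //; rewrite subr_ge0.
Qed.

Lemma ler_bern_expect F1 F2 : (forall g, F1 g <= F2 g) ->
  bern_expect F1 <= bern_expect F2.
Proof.
by move=> leF; apply: ler_sum => g _; rewrite ler_wpM2l ?bern_mass_ge0.
Qed.

(** * Trace moments of matrix series with centred Bernoulli coefficients *)

Section MatrixSeries.
Variables (n : nat) (H : K -> 'M[R]_n).
Hypothesis Hsym : forall k, (H k)^T = H k.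

Definition bern_series g : 'M[R]_n := \sum_k ((g k)%:R - q k) *: H k.

Lemma bern_series_sym g : (bern_series g)^T = bern_series g.
Proof.
by rewrite /bern_series linear_sum; apply: eq_bigr => k _; rewrite linearZ /= Hsym.
Qed.

Lemma bern_series_set_edge k g :
  bern_series (set_edge k true g) - bern_series (set_edge k false g) = H k.
Proof.
rewrite /bern_series -sumrB (bigD1 k) //= big1 => [|j /negbTE jk].
  by rewrite !ffunE eqxx -scalerBl addr0 mulr1n mulr0n sub0r opprK subrK scale1r.
by rewrite !ffunE jk subrr.
Qed.

(** One factor of the power is expanded over [k]. By [bern_stein] its coefficient becomes a
    difference of odd powers of two series that differ by [H k], which [mxtrace_subX_le] bounds. *)
Lemma bern_series_mxtrace_le m :
  bern_expect (fun g => \tr (bern_series g ^+ m.+1.*2)) <=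
  m.+1%:R * bern_expect (fun g =>
     \sum_k ((g k)%:R + q k) * \tr (H k *m H k *m bern_series g ^+ m.*2)).
Proof.
have -> : bern_expect (fun g => \tr (bern_series g ^+ m.+1.*2)) =
    \sum_k bern_expect (fun g =>
      ((g k)%:R - q k) * \tr (H k *m bern_series g ^+ m.*2.+1)).
  rewrite -bern_expect_sum; apply: eq_bern_expect => g.
  rewrite doubleS exprS [X in \tr (X * _)]/bern_series mulr_suml raddf_sum.
  apply: eq_bigr => k _; rewrite -mxtraceZ scalemxAl //.
rewrite bern_expect_sum big_distrr; apply: ler_sum => k _ /=.
rewrite bern_stein.
pose T g := \tr (H k *m H k *m bern_series g ^+ m.*2).
have T0 g : 0 <= T g by exact: mxtrace_sqrX_even_ge0 (Hsym k) (bern_series_sym g).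
have qk := q01 k.
apply: (@le_trans _ _ (bern_expect (fun g => m.+1%:R *
    (q k * (1 - q k) * (T (set_edge k true g) + T (set_edge k false g)))))).
  apply: ler_bern_expect => g; rewrite mulrCA; apply: ler_wpM2l; first by nra.
  rewrite -linearB -mulmxBr /=.
  have := mxtrace_subX_le m (bern_series_sym (set_edge k true g))
           (bern_series_sym (set_edge k false g)).
  rewrite bern_series_set_edge -/(T _) -/(T _) => /le_trans -> //.
  apply: ler_wpM2r; first by rewrite addr_ge0.
  (* The factor [m.*2.+1 / 2] is rounded up to [m.+1]. *)
  by rewrite ler_pdivrMr // -natrM ler_nat muln2 doubleS ltnW.
rewrite bern_expectZ bern_expect_flip; apply: ler_wpM2l => //.
(* The weight is [1 - q k] if [g k] holds and [q k] otherwise, at most [(g k)%:R + q k] in both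
   cases. *)
apply: ler_bern_expect => g; apply: ler_wpM2r => //.
by case: (g k); rewrite ?mulr1n ?mulr0n; lra.
Qed.

Variable h : K -> 'I_n -> R.
Hypothesis h_ge0 : forall k i, 0 <= h k i.
Hypothesis sqrH : forall k, H k *m H k = diag_mx (\row_i h k i).

Definition bern_var g (i : 'I_n) : R := \sum_k ((g k)%:R + q k) * h k i.

Lemma bern_var_ge0 g i : 0 <= bern_var g i.
Proof.
by apply: sumr_ge0 => k _; have /andP[? _] := q01 k; rewrite mulr_ge0 ?addr_ge0.
Qed.

(* Young's inequality absorbs the lower trace moment into the left-hand side. *)
Theorem bern_series_moment_le m :
  bern_expect (fun g => \tr (bern_series g ^+ m.+1.*2)) <=
  \sum_i bern_expect (fun g => (m.+1%:R * bern_var g i) ^+ m.+1).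
Proof.
set T := bern_expect _; set S := \sum_i _.
suff : m.+1%:R * T <= S + m%:R * T by rewrite -natr1; lra.
apply: (le_trans (ler_wpM2l _ (bern_series_mxtrace_le m))) => //.
rewrite -bern_expectZ -bern_expectZ -[S]bern_expect_sum -bern_expectZ -bern_expectD.
apply: ler_bern_expect => g.
have -> : \sum_k ((g k)%:R + q k) * \tr (H k *m H k *m bern_series g ^+ m.*2) =
    \sum_i bern_var g i * (bern_series g ^+ m.*2) i i.
  under [RHS]eq_bigr => i _ do rewrite big_distrl.
  rewrite exchange_big; apply: eq_bigr => k _ /=.
  rewrite sqrH mul_diag_mx /mxtrace big_distrr; apply: eq_bigr => i _ /=.
  by rewrite !mxE mulrA.
rewrite !big_distrr -big_split; apply: ler_sum => i _ /=.
have /(diag_expr_young m i (bern_series_sym g)) : 0 <= m.+1%:R * bern_var g i.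
  by rewrite mulr_ge0 ?bern_var_ge0.
by rewrite !mulrA.
Qed.
End MatrixSeries.
End BernoulliCube.

(** * Chernoff bounds for weighted Bernoulli sums *)

Section ExponentialMoments.
Variable R : realType.

(** [expR (- x) >= 1 - x] gives [expR x <= 1 / (1 - x)], which is at most [1 + 2 * x] on this
    range. *)
Lemma expR_le1D2x (x : R) : 0 <= x <= 2^-1 -> expR x <= 1 + 2 * x.
Proof.
move=> /andP[x0 x1]; have := expR_ge1Dx (- x); have := expR_gt0 x.
have : expR x * expR (- x) = 1 by rewrite -expRD subrr expR0.
set u := expR x; set v := expR (- x) => uv u0 v1.
have : u * (1 - x) <= 1 by nra.
nra.
Qed.

Variables (K : finType) (q : K -> R).
Hypothesis q01 : forall k, 0 <= q k <= 1.
Variable c : K -> R.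
Hypothesis c01 : forall k, 0 <= c k <= 1.

(** By independence one factor suffices. Of the constant 3, one unit comes from the deterministic
    [q k] in the exponent and two from [expR_le1D2x]. *)
Lemma bern_expect_expR_le (t : R) : 0 <= t <= 2^-1 ->
  bern_expect q (fun g => expR (t * \sum_k ((g k)%:R + q k) * c k)) <=
  expR (3 * t * \sum_k q k * c k).
Proof.
move=> /andP[t0 t1].
pose f k (b : bool) : R := expR (t * ((b%:R + q k) * c k)).
rewrite (@eq_bern_expect _ _ q _ (fun g => \prod_k f k (g k))); last first.
  by move=> g; rewrite big_distrr expR_sum.
rewrite bern_expect_prod big_distrr expR_sum; apply: ler_prod => k _ /=.
have /andP[q0 q1] := q01 k; have /andP[c0 c1] := c01 k.
apply/andP; split; first by rewrite addr_ge0 ?mulr_ge0 ?expR_ge0 ?subr_ge0.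
rewrite /f mulr0n mulr1n add0r.
have -> : t * ((1 + q k) * c k) = t * (q k * c k) + t * c k by ring.
have -> : 3 * t * (q k * c k) = t * (q k * c k) + 2 * (t * c k) * q k by ring.
rewrite !expRD mulrCA [(1 - q k) * _]mulrC -mulrDr; apply: ler_wpM2l; first exact: expR_ge0.
have tc : 0 <= t * c k <= 2^-1 by nra.
have := expR_le1D2x tc; have := expR_ge1Dx (2 * (t * c k) * q k).
set u := expR _; set v := expR _; nra.
Qed.

Lemma bern_expect_moment_le (W : R) p : (0 < p)%N -> p%:R <= 3 * W ->
  \sum_k q k * c k <= W ->
  bern_expect q (fun g => (\sum_k ((g k)%:R + q k) * c k) ^+ p) <= (6 * W) ^+ p.
Proof.
move=> p_gt0 pW leW.
have p0 : 0 < p%:R :> R by rewrite ltr0n.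
have W0 : 0 < W by nra.
(* With [y = D / (6 * W)] one has [t * D = p * y], and [y ^+ p <= expR (p * (y - 1))]. The
   hypothesis [p <= 3 * W] says [t <= 1/2]; the exponential moment is then at most [expR (p / 2)],
   which [expR (- p)] absorbs. *)
pose t := p%:R / (6 * W).
have t01 : 0 <= t <= 2^-1.
  by rewrite divr_ge0 ?ler_pdivrMr //=; nra.
have tW : t * (6 * W) = p%:R by rewrite divfK //; apply: lt0r_neq0; nra.
apply: (@le_trans _ _ (bern_expect q (fun g => (6 * W) ^+ p * expR (- p%:R) *
    expR (t * \sum_k ((g k)%:R + q k) * c k)))).
  apply: ler_bern_expect => // g; set D := \sum_k _.
  have D0 : 0 <= D.
    apply: sumr_ge0 => k _; have /andP[? _] := q01 k; have /andP[? _] := c01 k.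
    by rewrite mulr_ge0 ?addr_ge0.
  pose y := D / (6 * W).
  have yE : D = 6 * W * y by rewrite mulrC divfK //; apply: lt0r_neq0; nra.
  have y0 : 0 <= y by rewrite divr_ge0 //; nra.
  have -> : t * D = p%:R * y by rewrite yE mulrA tW.
  rewrite -mulrA -expRD yE exprMn; apply: ler_wpM2l; first by rewrite exprn_ge0; nra.
  have -> : - p%:R + p%:R * y = p%:R * (y - 1) by ring.
  rewrite expRM_natl; apply: lerXn2r => //; rewrite ?nnegrE ?expR_ge0 //.
  by have := expR_ge1Dx (y - 1); rewrite addrC subrK.
rewrite bern_expectZ -mulrA -[leRHS]mulr1; apply: ler_wpM2l.
  by rewrite exprn_ge0; nra.
apply: (le_trans (ler_wpM2l (expR_ge0 _) (bern_expect_expR_le t01))).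
by rewrite -expRD expR_le1; nra.
Qed.
End ExponentialMoments.

(** * The random graph as a Bernoulli matrix series, and the tail of its noise *)

Section RandomGraph.
Variables (R : realType) (n : nat).
Implicit Types (a b c : 'I_n) (k : 'I_n * 'I_n).

(** An unordered pair is encoded by its increasing representative, so that edges are indexed by a
    product type; pairs with [k.1 > k.2] are dummy indices. *)
Definition edge a b : 'I_n * 'I_n := if (a <= b)%N then (a, b) else (b, a).

Lemma edgeC a b : edge a b = edge b a.
Proof.
rewrite /edge; case: ltngtP => // ab.
by have -> : a = b by apply: val_inj.
Qed.

Lemma edge_inj a : injective (edge a).
Proof.
move=> b c; rewrite /edge.
by case: leqP => ab; case: leqP => ac [] *; subst; rewrite ?ltnn in ab ac *.
Qed.

Definition edge_mx k : 'M[R]_n := \matrix_(a, b) (k == edge a b)%:R.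

Lemma edge_mx_sym k : (edge_mx k)^T = edge_mx k.
Proof. by apply/matrixP => a b; rewrite !mxE edgeC. Qed.

Definition edge_deg k a : R := \sum_c (k == edge a c)%:R.

Lemma edge_deg_ge0 k a : 0 <= edge_deg k a.
Proof. by apply: sumr_ge0. Qed.

Lemma edge_deg_le1 k a : edge_deg k a <= 1.
Proof.
rewrite /edge_deg; case: (pickP (fun c => k == edge a c)) => [c /eqP kE|no].
  rewrite (bigD1 c) //= kE eqxx big1 ?addr0 // => d dc.
  by rewrite (inj_eq (@edge_inj a)) eq_sym (negbTE dc).
by rewrite big1 // => c _; rewrite no.
Qed.

(** A nonzero entry at [(a, b)] needs a vertex [c] with [edge a c = edge c b], which forces
    [a = b]. *)
Lemma sqr_edge_mx k : edge_mx k *m edge_mx k = diag_mx (\row_a edge_deg k a).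
Proof.
apply/matrixP => a b; rewrite !mxE; case: (eqVneq a b) => [<-|ab].
  rewrite mulr1n; apply: eq_bigr => c _; rewrite !mxE (edgeC c a).
  by case: eqP; rewrite ?mulr1 ?mulr0.
rewrite mulr0n big1 // => c _; rewrite !mxE.
case: eqP => [->|]; last by rewrite mul0r.
case: eqP => [|]; last by rewrite mulr0.
by rewrite edgeC => /edge_inj /eqP; rewrite (negbTE ab).
Qed.

Definition graph_of (g : {ffun 'I_n * 'I_n -> bool}) : {ffun 'I_n * 'I_n -> bool} :=
  [ffun p => g (edge p.1 p.2)].

Variables (loops : bool) (w : 'I_n -> R).

(** Probability 0 at the dummy indices confines the product measure to upper triangular
    configurations. *)
Definition edge_prob k : R := if (k.1 <= k.2)%N then Abar loops w k.1 k.2 else 0.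

Lemma AbarC a b : Abar loops w a b = Abar loops w b a.
Proof. by rewrite /Abar eq_sym [w a * _]mulrC. Qed.

Lemma edge_probE a b : edge_prob (edge a b) = Abar loops w a b.
Proof.
rewrite /edge_prob /edge; case: (leqP a b) => /= [->//|/ltnW ->].
exact: AbarC.
Qed.

(* [graph_of] is a bijection from the upper triangular indicators, which carry all the mass of
   the product measure, onto the symmetric ones. *)
Lemma graph_mass_expect (F : {ffun 'I_n * 'I_n -> bool} -> R) :
  \sum_e graph_mass loops w e * F e = bern_expect edge_prob (fun g => F (graph_of g)).
Proof.
pose sym (e : {ffun 'I_n * 'I_n -> bool}) := [forall i, forall j, e (i, j) == e (j, i)].
pose upper (g : {ffun 'I_n * 'I_n -> bool}) := [forall p, g p ==> (p.1 <= p.2)%N].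
pose restr (e : {ffun 'I_n * 'I_n -> bool}) : {ffun 'I_n * 'I_n -> bool} :=
  [ffun p : 'I_n * 'I_n => (p.1 <= p.2)%N && e p].
have edge_le (p : 'I_n * 'I_n) : (p.1 <= p.2)%N -> edge p.1 p.2 = p.
  by case: p => a b /= ab; rewrite /edge ab.
rewrite (bigID sym) /= addrC big1 ?add0r; last first.
  by move=> e esym; rewrite /graph_mass -/(sym e) (negbTE esym) !mul0r.
rewrite (reindex_onto graph_of restr) /=; last first.
  move=> e /'forall_forallP esym; apply/ffunP => -[a b]; rewrite !ffunE /edge /=.
  case: (leqP a b) => /= [->//|/ltnW ->]; exact/eqP/esym.
rewrite /bern_expect [RHS](bigID upper) /= [X in _ = _ + X]big1 ?addr0; last first.
  move=> g /forallPn[p]; rewrite negb_imply => /andP[gp /negbTE pp].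
  by rewrite /bern_mass (bigD1 p) //= /bern_weight gp /edge_prob pp !mul0r.
apply: eq_big => [g|g /andP[gsym /eqP gE]].
  have -> : sym (graph_of g).
    by apply/'forall_forallP => a b; rewrite !ffunE /= edgeC.
  rewrite /=; apply/eqP/forallP => [<- p|up].
    by rewrite ffunE; apply/implyP => /andP[].
  apply/ffunP => p; rewrite !ffunE; case: leqP => /= pp; first by rewrite edge_le.
  by have := up p; rewrite leqNgt pp; case: (g p).
rewrite /graph_mass -/(sym _) gsym mul1r; congr (_ * _).
rewrite /bern_mass [RHS](bigID (fun p : 'I_n * 'I_n => (p.1 <= p.2)%N)) /= [X in _ = _ * X]big1 ?mulr1.
  by apply: eq_bigr => p pp; rewrite ffunE edge_le // /bern_weight /edge_prob pp.
move=> p pp; have := congr1 (fun f : {ffun _ -> bool} => f p) gE.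
by rewrite ffunE (negbTE pp) /bern_weight /edge_prob (negbTE pp) => <-; rewrite subr0.
Qed.

Lemma Gw_prob_expect (P : 'M[R]_n -> Prop) :
  Gw_prob loops w P = bern_expect edge_prob (fun g => `[< P (adj R (graph_of g)) >]%:R).
Proof.
rewrite -(graph_mass_expect (fun e => `[< P (adj R e) >]%:R)) /Gw_prob big_mkcond.
by apply: eq_bigr => e _; case: asboolP; rewrite ?mulr1 ?mulr0.
Qed.

Definition noise_mx g : 'M[R]_n := bern_series edge_prob edge_mx g.

Lemma noise_mxE g a b : noise_mx g a b = adj R (graph_of g) a b - Abar loops w a b.
Proof.
rewrite /noise_mx /bern_series summxE (bigD1 (edge a b)) //= !mxE eqxx mulr1.
rewrite big1 ?addr0 => [|k kE]; first by rewrite edge_probE ffunE.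
by rewrite !mxE (negbTE kE) mulr0.
Qed.

Lemma sum_edge_prob a : \sum_k edge_prob k * edge_deg k a = \sum_c Abar loops w a c.
Proof.
under eq_bigr => k _ do rewrite big_distrr.
rewrite exchange_big; apply: eq_bigr => c _ /=.
rewrite (bigD1 (edge a c)) //= eqxx mulr1 edge_probE big1 ?addr0 // => k kE.
by rewrite (negbTE kE) mulr0.
Qed.

Hypothesis w_gt0 : forall i, 0 < w i.
Hypothesis wmax_le : wmax w <= Num.sqrt (wsum w).

Lemma le_wmax i : w i <= wmax w.
Proof. exact: le_bigmax. Qed.

Lemma wsum_ge0 : 0 <= wsum w.
Proof. by apply: sumr_ge0 => i _; apply: ltW. Qed.

Lemma wsum_gt0 : 'I_n -> 0 < wsum w.
Proof.
move=> i; rewrite /wsum (bigD1 i) //=; apply: ltr_wpDr => //.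
by apply: sumr_ge0 => j _; apply: ltW.
Qed.

(** The bound of [wmax] by the square root of the total weight enters here, to make [Abar] a
    probability. *)
Lemma mul_le_wsum a b : w a * w b <= wsum w.
Proof.
rewrite -[leRHS]sqr_sqrtr ?wsum_ge0 // expr2.
by apply: ler_pM; rewrite ?(ltW (w_gt0 _)) // (le_trans (le_wmax _)).
Qed.

Lemma Abar_ge0 a b : 0 <= Abar loops w a b.
Proof.
rewrite /Abar; case: ifP => // _.
by rewrite divr_ge0 ?mulr_ge0 ?wsum_ge0 ?(ltW (w_gt0 _)).
Qed.

Lemma Abar_le a b : Abar loops w a b <= w a * w b / wsum w.
Proof.
rewrite /Abar; case: ifP => // _.
by rewrite divr_ge0 ?mulr_ge0 ?wsum_ge0 ?(ltW (w_gt0 _)).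
Qed.

Lemma Abar_le1 a b : Abar loops w a b <= 1.
Proof.
apply: (le_trans (Abar_le a b)).
by rewrite ler_pdivrMr ?mul1r ?mul_le_wsum ?(wsum_gt0 a).
Qed.

Lemma edge_prob01 k : 0 <= edge_prob k <= 1.
Proof.
rewrite /edge_prob; case: ifP => _; last by rewrite lexx ler01.
by rewrite Abar_ge0 Abar_le1.
Qed.

Lemma sum_Abar_le a : \sum_c Abar loops w a c <= wmax w.
Proof.
apply: (le_trans _ (le_wmax a)).
apply: (@le_trans _ _ (\sum_c w a * w c / wsum w)).
  by apply: ler_sum => c _; apply: Abar_le.
by rewrite -big_distrl -big_distrr /= -/(wsum w) mulfK // lt0r_neq0 ?(wsum_gt0 a).
Qed.

Lemma noise_moment_le m : m.+1%:R <= 3 * wmax w ->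
  bern_expect edge_prob (fun g => \tr (noise_mx g ^+ m.+1.*2)) <=
    n%:R * (m.+1%:R * (6 * wmax w)) ^+ m.+1.
Proof.
move=> mW; apply: (le_trans (bern_series_moment_le edge_prob01 edge_mx_sym
  edge_deg_ge0 sqr_edge_mx m)).
set B := (_ * (6 * _)) ^+ _.
have -> : n%:R * B = \sum_(i < n) B by rewrite sumr_const card_ord mulr_natl.
apply: ler_sum => i _; rewrite {}/B.
rewrite (@eq_bern_expect _ _ edge_prob _ (fun g => m.+1%:R ^+ m.+1 *
   bern_var edge_prob edge_deg g i ^+ m.+1)) => [|g]; last by rewrite exprMn.
rewrite bern_expectZ exprMn; apply: ler_wpM2l; first by rewrite exprn_ge0.
apply: (bern_expect_moment_le edge_prob01) => //.
  by move=> k; rewrite edge_deg_ge0 edge_deg_le1.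
by rewrite sum_edge_prob sum_Abar_le.
Qed.

(** Markov's inequality in pointwise form: the indicator plus the trace divided by [B ^+ m.+1] is at
    least 1. As [24 = 4 * 6], [B] is four times the base in [noise_moment_le]. *)
Lemma noise_tail m : m.+1%:R <= 3 * wmax w ->
  bern_expect edge_prob (fun g =>
    (\tr (noise_mx g ^+ m.+1.*2) < (24 * m.+1%:R * wmax w) ^+ m.+1)%R%:R) >=
  1 - n%:R / 4 ^+ m.+1.
Proof.
move=> mW; set B := 24 * m.+1%:R * wmax w.
have B0 : 0 < B ^+ m.+1.
  have m0 : 0 < m.+1%:R :> R by rewrite ltr0n.
  by apply: exprn_gt0; rewrite /B; nra.
have := noise_moment_le mW; have := bern_mass_sum1 edge_prob.
set T := fun g => \tr (noise_mx g ^+ m.+1.*2).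
rewrite -/(bern_expect _ T) => M1 momT.
have T0 g : 0 <= T g.
  have := mxtrace_sqrX_even_ge0 m.+1 (@trmx1 R n) (bern_series_sym edge_prob edge_mx_sym g).
  by rewrite mulmx1 mul1mx.
have E1 : bern_expect edge_prob (fun=> 1) = 1.
  by rewrite -[RHS]M1; apply: eq_bigr => g _; rewrite mulr1.
have -> : n%:R / 4 ^+ m.+1 = (B ^+ m.+1)^-1 * (n%:R * (m.+1%:R * (6 * wmax w)) ^+ m.+1).
  have BE : B = 4 * (m.+1%:R * (6 * wmax w)) by rewrite /B; ring.
  move: (lt0r_neq0 B0); rewrite BE exprMn mulf_eq0 negb_or => /andP[].
  by move: ((4 : R) ^+ m.+1) (_ ^+ _) => x y x0 y0; field; rewrite x0 y0.
rewrite lerBlDr -[leLHS]E1.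
apply: (le_trans _ (lerD (lexx _) (ler_wpM2l _ momT))); last by rewrite invr_ge0 ltW.
rewrite -bern_expectZ -bern_expectD.
apply: (ler_bern_expect edge_prob01) => g.
case: ltP => TB; first by rewrite lerDl mulr_ge0 ?invr_ge0 // ltW.
by rewrite add0r mulrC ler_pdivlMr // mul1r.
Qed.
End RandomGraph.

(** * Euclidean geometry, quadratic forms and the top eigenvector *)

Section Euclidean.
Variables (R : realType) (n : nat).
Implicit Types (x y z : 'cV[R]_n) (A X : 'M[R]_n).

Definition dotv x y : R := (x^T *m y) 0 0.

Lemma dotvE x y : dotv x y = \sum_i x i 0 * y i 0.
Proof. by rewrite /dotv mxE; apply: eq_bigr => i _; rewrite mxE. Qed.

Lemma dotvC x y : dotv x y = dotv y x.
Proof. by rewrite !dotvE; apply: eq_bigr => i _; rewrite mulrC. Qed.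

Lemma dotvDr x y z : dotv x (y + z) = dotv x y + dotv x z.
Proof. by rewrite /dotv mulmxDr mxE. Qed.

Lemma dotv0 x : dotv x 0 = 0.
Proof. by rewrite /dotv mulmx0 mxE. Qed.

Lemma dotvZr c x y : dotv x (c *: y) = c * dotv x y.
Proof. by rewrite /dotv -scalemxAr mxE. Qed.

Lemma dotvBr x y z : dotv x (y - z) = dotv x y - dotv x z.
Proof. by rewrite -scaleN1r dotvDr dotvZr mulN1r. Qed.

Lemma dotv_sym A x y : A^T = A -> dotv (A *m x) y = dotv x (A *m y).
Proof. by move=> Asym; rewrite /dotv trmx_mul Asym mulmxA. Qed.

Lemma norm2_ge0 x : 0 <= norm2 x.
Proof. exact: sqrtr_ge0. Qed.

Lemma sqr_norm2 x : norm2 x ^+ 2 = dotv x x.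
Proof.
rewrite /norm2 sqr_sqrtr; last by apply: sumr_ge0 => i _; rewrite sqr_ge0.
by rewrite dotvE.
Qed.

Lemma dotv_ge0 x : 0 <= dotv x x.
Proof. by rewrite -sqr_norm2 sqr_ge0. Qed.

Lemma dotv_eq0 x : (dotv x x == 0) = (x == 0).
Proof.
apply/eqP/eqP => [|->]; last by rewrite dotvE big1 // => i _; rewrite !mxE mul0r.
rewrite dotvE => /eqP; rewrite psumr_eq0 => [|i _]; last by rewrite -expr2 sqr_ge0.
move=> /allP x0; apply/colP => i; rewrite !mxE; apply/eqP.
by have := x0 i (mem_index_enum i); rewrite mulf_eq0 orbb.
Qed.

Lemma norm2_eq0 x : norm2 x = 0 -> x = 0.
Proof. by move=> x0; apply/eqP; rewrite -dotv_eq0 -sqr_norm2 x0 expr0n. Qed.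

Lemma dot_norm2 x y : `|dotv x y| <= norm2 x * norm2 y.
Proof.
have CS a b : dotv a b <= norm2 a * norm2 b.
  have [/norm2_eq0 ->|na] := eqVneq (norm2 a) 0.
    by rewrite dotvC dotv0 mulr_ge0 ?norm2_ge0.
  have [/norm2_eq0 ->|nb] := eqVneq (norm2 b) 0.
    by rewrite dotv0 mulr_ge0 ?norm2_ge0.
  have a0 : 0 < norm2 a by rewrite lt_neqAle eq_sym na norm2_ge0.
  have b0 : 0 < norm2 b by rewrite lt_neqAle eq_sym nb norm2_ge0.
  (* Expanding this square gives [2 * (p * q) * (p * q - d)], whence Cauchy-Schwarz. *)
  have := dotv_ge0 (norm2 b *: a - norm2 a *: b).
  rewrite dotvBr !dotvZr ![dotv (_ - _) _]dotvC !dotvBr !dotvZr -!sqr_norm2 (dotvC b a).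
  move: (norm2 a) (norm2 b) (dotv a b) a0 b0 => p q d p0 q0.
  have -> : q * (q * p ^+ 2 - p * d) - p * (q * d - p * q ^+ 2) =
    2 * (p * q) * (p * q - d) by ring.
  by rewrite pmulr_rge0 ?subr_ge0 //; nra.
rewrite ler_norml CS andbT; have := CS x (- y).
have -> : norm2 (- y) = norm2 y.
  by congr Num.sqrt; apply: eq_bigr => i _; rewrite mxE sqrrN.
by rewrite -scaleN1r dotvZr mulN1r lerNl.
Qed.

Lemma norm2D x y : norm2 (x + y) <= norm2 x + norm2 y.
Proof.
rewrite -(ler_pXn2r (n := 2)) ?nnegrE ?addr_ge0 ?norm2_ge0 //.
rewrite sqr_norm2 !dotvDr ![dotv (x + y) _]dotvC !dotvDr (dotvC y x) -!sqr_norm2.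
have := le_trans (ler_norm _) (dot_norm2 x y); nra.
Qed.

Lemma norm2Z c x : norm2 (c *: x) = `|c| * norm2 x.
Proof.
apply/eqP; rewrite -(eqrXn2 (n := 2)) ?mulr_ge0 ?norm2_ge0 //.
rewrite exprMn !sqr_norm2 dotvZr dotvC dotvZr mulrA real_normK ?num_real //.
Qed.

(** Even powers of eigenvalues are nonnegative, so each is at most the trace; this bounds every
    [lam j ^+ 2] by [B]. *)
Lemma quadform_le_mxtrace X x (B : R) m : X^T = X -> 0 <= B ->
  \tr (X ^+ m.+1.*2) <= B ^+ m.+1 ->
  `|dotv x (X *m x)| <= Num.sqrt B * dotv x x.
Proof.
move=> Xsym B0 trB; have [lam [trE [_ /(_ x) [c c0 cE]]]] := spectral_mxtrace Xsym.
have lamB j : `|lam j| <= Num.sqrt B.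
  rewrite -(ler_pXn2r (n := 2)) ?nnegrE ?sqrtr_ge0 // sqr_sqrtr // real_normK ?num_real //.
  rewrite -(ler_pXn2r (n := m.+1)) ?nnegrE ?sqr_ge0 // -exprM mul2n.
  apply: le_trans trB; rewrite trE (bigD1 j) //= lerDl.
  by apply: sumr_ge0 => i _; rewrite -mul2n exprM exprn_ge0 ?sqr_ge0.
have -> : dotv x (X *m x) = \sum_j c j * lam j.
  by have := cE 1; rewrite expr1 /dotv mulmxA => ->; apply: eq_bigr => j _; rewrite expr1.
have -> : dotv x x = \sum_j c j.
  by have := cE 0; rewrite expr0 mulmx1 /dotv => ->; apply: eq_bigr => j _; rewrite expr0 mulr1.
rewrite big_distrr; apply: (le_trans (ler_norm_sum _ _ _)); apply: ler_sum => j _.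
by rewrite normrM ger0_norm // mulrC ler_wpM2r.
Qed.

Lemma top_eigenvector A : (0 < n)%N -> A^T = A ->
  exists (lam : R) (u : 'cV[R]_n), norm2 u = 1 /\ A *m u = lam *: u /\
    (forall x, dotv x (A *m x) <= lam * dotv x x) /\
    eigenvalue (map_mx (real_complex R) A) (real_complex R lam).
Proof.
move=> n0 Asym; have [lam [_ [eig form]]] := spectral_mxtrace Asym.
pose j0 := Order.arg_max (Ordinal n0) xpredT lam.
have lam_le j : lam j <= lam j0.
  by rewrite /j0; case: arg_maxP => // i _ /(_ j isT).
(* The eigenvalue is known over [R[i]]; as a root of the characteristic polynomial it descends to
   [R] and has a real eigenvector. *)
have /eigenvalueP [v vE v0] : eigenvalue A (lam j0).
  rewrite eigenvalue_root_char -(fmorph_root (real_complex R)) map_char_poly.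
  by rewrite -eigenvalue_root_char; apply: eig.
pose z := v^T; have z0 : norm2 z != 0.
  by apply: contraNneq v0 => /norm2_eq0 /(congr1 trmx); rewrite trmxK trmx0 => ->.
have zE : A *m z = lam j0 *: z by rewrite -{1}Asym -trmx_mul vE linearZ.
exists (lam j0), ((norm2 z)^-1 *: z); split; last split; last split => //.
- by rewrite norm2Z ger0_norm ?invr_ge0 ?norm2_ge0 // mulVf.
- by rewrite -scalemxAr zE scalerA mulrC -scalerA.
move=> x; have [c c0 cE] := form x.
have -> : dotv x (A *m x) = \sum_j c j * lam j.
  by have := cE 1; rewrite expr1 /dotv mulmxA => ->; apply: eq_bigr => j _; rewrite expr1.
have -> : dotv x x = \sum_j c j.
  by have := cE 0; rewrite expr0 mulmx1 /dotv => ->; apply: eq_bigr => j _; rewrite expr0 mulr1.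
rewrite big_distrr; apply: ler_sum => j _; rewrite [leRHS]mulrC.
exact: ler_wpM2l.
Qed.
End Euclidean.

(** Closing arithmetic of [welfare_rank_one]: [1 - e / 5] scales the lower bound along [v],
    [1 + e / 15] the upper bound for the optimum. *)
Lemma ratio_le (R : realType) (e : R) : 0 < e -> e < 1 ->
  (1 - e) * (1 + e / 15) ^+ 2 <= (1 - e / 5) ^+ 2.
Proof. by move=> e0 e1; nra. Qed.

(** * Resolvent and welfare for a matrix close to a rank one matrix *)

Section RankOnePerturbation.
Variables (R : realType) (n : nat) (A : 'M[R]_n) (v : 'cV[R]_n) (t r : R).
Hypothesis n_gt0 : (0 < n)%N.
Hypothesis Asym : A^T = A.
Hypothesis v_unit : norm2 v = 1.
Hypothesis A_near : forall x, `|dotv x (A *m x) - t * dotv v x ^+ 2| <= r * dotv x x.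

Section Resolvent.
Variables (beta lam : R) (u : 'cV[R]_n).
Hypothesis beta_gt0 : 0 < beta.
Hypothesis lam_lt : beta * lam < 1.
Hypothesis u_unit : norm2 u = 1.
Hypothesis u_eig : A *m u = lam *: u.
Hypothesis lam_top : forall x, dotv x (A *m x) <= lam * dotv x x.

Let M := 1%:M - beta *: A.
Let mu := (1 - beta * lam)^-1.

Let mu_gt0 : 0 < 1 - beta * lam. Proof. by rewrite subr_gt0. Qed.

Lemma resolvent_sym : M^T = M.
Proof. by rewrite linearB linearZ /= trmx1 Asym. Qed.

Lemma resolvent_coercive x : (1 - beta * lam) * dotv x x <= dotv x (M *m x).
Proof.
rewrite mulmxBl mul1mx -scalemxAl dotvBr dotvZr.
by have := ler_wpM2l (ltW beta_gt0) (lam_top x); nra.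
Qed.

Lemma resolvent_unit : M \in unitmx.
Proof.
rewrite unitmxE unitfE; apply/det0P => -[z z0 zM].
have : M *m z^T = 0 by rewrite -resolvent_sym -trmx_mul zM trmx0.
move=> Mz; have := resolvent_coercive z^T.
rewrite Mz dotv0 pmulr_rle0 // => le0.
have /eqP : dotv z^T z^T = 0 by apply/eqP; rewrite eq_le le0 dotv_ge0.
by rewrite dotv_eq0 => /eqP /(congr1 trmx); rewrite trmxK trmx0; apply/eqP.
Qed.

Lemma norm2_resolvent_le z : norm2 (invmx M *m z) <= mu * norm2 z.
Proof.
set x := _ *m z; have Mx : M *m x = z by rewrite mulKVmx ?resolvent_unit.
have := resolvent_coercive x; rewrite Mx -sqr_norm2 => coer.
have := le_trans coer (le_trans (ler_norm _) (dot_norm2 x z)).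
rewrite /mu [_^-1 * _]mulrC ler_pdivlMr //.
have [->|x0] := eqVneq (norm2 x) 0; first by move=> _; rewrite mul0r norm2_ge0.
have xp : 0 < norm2 x by rewrite lt_neqAle eq_sym x0 norm2_ge0.
by rewrite expr2 mulrCA ler_pM2l // mulrC.
Qed.

(** The inverse multiplies the component along [u] by [mu]; Cauchy-Schwarz against [u] discards the
    rest. *)
Lemma norm2_resolvent_ge z : mu * `|dotv u z| <= norm2 (invmx M *m z).
Proof.
set x := _ *m z; have Mx : M *m x = z by rewrite mulKVmx ?resolvent_unit.
have Mu : M *m u = (1 - beta * lam) *: u.
  by rewrite mulmxBl mul1mx -scalemxAl u_eig scalerA scalerBl scale1r.
rewrite -Mx -dotv_sym ?resolvent_sym // Mu dotvC dotvZr normrM gtr0_norm //.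
rewrite mulrA mulVf ?gt_eqF // mul1r.
by apply: le_trans (dot_norm2 _ _) _; rewrite u_unit mulr1.
Qed.

Lemma top_eigenvalue_ge : t - r <= lam.
Proof.
have vv : dotv v v = 1 by rewrite -sqr_norm2 v_unit expr1n.
have := A_near v; have := lam_top v; rewrite vv expr1n !mulr1 ler_norml.
by move=> ? /andP[? _]; lra.
Qed.

(** [lam] is the form of [A] at [u], hence at most [t * dotv v u ^+ 2 + r], while testing at [v]
    gives [t - r <= lam]. *)
Lemma top_eigenvector_align : t - 2 * r <= t * dotv v u ^+ 2.
Proof.
have uu : dotv u u = 1 by rewrite -sqr_norm2 u_unit expr1n.
have := A_near u; have := top_eigenvalue_ge.
by rewrite u_eig dotvZr uu !mulr1 ler_norml => ? /andP[_ ?]; lra.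
Qed.
End Resolvent.

Theorem welfare_rank_one (beta eps C : R) (b ystar : 'cV[R]_n) :
  0 < t -> r <= eps * t / 50 -> 0 < beta -> 0 < eps < 1 ->
  256 * norm2 b ^+ 2 / (eps * beta * t) ^+ 2 <= C ->
  spectral_radius_lt A beta^-1 -> norm2 ystar = Num.sqrt C ->
  (1 - eps) * welfare beta A b ystar <= welfare beta A b (Num.sqrt C *: v).
Proof.
move=> t0 rt beta0 /andP[eps0 eps1] Cb rho ystarC.
have [lam [u [u1 [uE [top eig]]]]] := top_eigenvector n_gt0 Asym.
have blam : beta * lam < 1.
  have := rho _ eig; rewrite normc_def /= expr0n addr0 sqrtr_sqr ltcR => lt.
  by rewrite mulrC -ltr_pdivlMr // mul1r (le_lt_trans (ler_norm lam)).
set s := Num.sqrt C; set c := `|dotv v u|; set nb := norm2 b.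
have s0 : 0 <= s by rewrite sqrtr_ge0.
have nb0 : 0 <= nb by rewrite norm2_ge0.
have c0 : 0 <= c by rewrite normr_ge0.
have c1 : c <= 1 by apply: le_trans (dot_norm2 _ _) _; rewrite v_unit u1 mulr1.
have c_ge : 1 - eps / 25 <= c.
  have := top_eigenvector_align u1 uE top.
  rewrite -[dotv v u ^+ 2]real_normK ?num_real // -/c => al.
  (* Here [2 * r <= eps * t / 25]; afterwards [c ^+ 2 <= c] because [c <= 1]. *)
  have : t * (1 - eps / 25) <= t * c ^+ 2 by lra.
  by rewrite ler_pM2l // => /le_trans -> //; rewrite expr2 ler_piMr.
(* The spectral radius condition bounds [t] itself, since [t - r <= lam < 1 / beta] and
   [r <= t / 50]. *)
have bt : beta * t <= 50 / 49.
  have := top_eigenvalue_ge top => lam_ge.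
  have : r <= t / 50 by apply: le_trans rt _; rewrite ler_pM2r //; nra.
  move=> rt'; have : t * (49 / 50) <= lam by lra.
  by move/(ler_wpM2l (ltW beta0)); lra.
have C0 : 0 <= C.
  by apply: le_trans Cb; rewrite divr_ge0 ?sqr_ge0 // mulr_ge0 ?sqr_ge0.
have ebt : 0 < eps * beta * t by rewrite !mulr_gt0.
have nb_le : nb <= s * eps / 15.
  (* Square root of the budget hypothesis, [16 ^+ 2 = 256]. With [bt] it gives
     [nb <= (50 / 784) * s * eps], below [s * eps / 15]. *)
  have : 16 * nb <= s * (eps * beta * t).
    rewrite -(ler_pXn2r (n := 2)) ?nnegrE ?(mulr_ge0 s0 (ltW ebt)) ?mulr_ge0 //.
    move: Cb; rewrite ler_pdivrMr ?exprn_gt0 // -/nb => Cb.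
    by rewrite [leRHS]exprMn sqr_sqrtr // exprMn; apply: le_trans Cb; lra.
  have : s * (eps * beta * t) <= s * eps * (50 / 49).
    have -> : s * (eps * beta * t) = s * eps * (beta * t) by ring.
    by rewrite ler_wpM2l ?mulr_ge0 // ltW.
  have : 0 <= s * eps by rewrite mulr_ge0 // ltW.
  by lra.
have mu0 : 0 < (1 - beta * lam)^-1 by rewrite invr_gt0 subr_gt0.
set mu := (1 - beta * lam)^-1 in mu0.
have up : norm2 (invmx (1%:M - beta *: A) *m (b + ystar)) <= mu * (nb + s).
  apply: le_trans (norm2_resolvent_le beta0 blam top _) _.
  by rewrite ler_pM2l // /s -ystarC norm2D.
have lo : mu * (s * c - nb) <= norm2 (invmx (1%:M - beta *: A) *m (b + s *: v)).
  apply: le_trans (norm2_resolvent_ge beta0 blam u1 uE top _).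
  rewrite ler_pM2l // dotvDr dotvZr (dotvC u v) [dotv u b + _]addrC.
  apply: le_trans (lerB_normD _ _); rewrite normrM (ger0_norm s0) -/c lerD2l lerN2.
  by apply: le_trans (dot_norm2 _ _) _; rewrite u1 mul1r.
rewrite /welfare mulrCA ler_pM2l ?invr_gt0 //.
have lo' : s * (1 - eps / 5) <= s * c - nb.
  have := ler_wpM2l s0 c_ge; have : 0 <= s * eps by rewrite mulr_ge0 // ltW.
  by lra.
have lo0 : 0 <= s * (1 - eps / 5) by apply: mulr_ge0 => //; lra.
have up' : nb + s <= s * (1 + eps / 15) by lra.
apply: (@le_trans _ _ ((1 - eps) * (mu * (s * (1 + eps / 15))) ^+ 2)).
  rewrite ler_wpM2l ?subr_ge0 ?(ltW eps1) //.
  rewrite lerXn2r ?nnegrE ?norm2_ge0 ?mulr_ge0 ?(ltW mu0) //; first by lra.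
  by apply: le_trans up _; rewrite ler_pM2l.
apply: (@le_trans _ _ ((mu * (s * (1 - eps / 5))) ^+ 2)); last first.
  rewrite lerXn2r ?nnegrE ?norm2_ge0 //; first by rewrite mulr_ge0 // ltW.
  by apply: le_trans lo; rewrite ler_pM2l.
have -> : (1 - eps) * (mu * (s * (1 + eps / 15))) ^+ 2 =
  (mu * s) ^+ 2 * ((1 - eps) * (1 + eps / 15) ^+ 2) by field.
have -> : (mu * (s * (1 - eps / 5))) ^+ 2 = (mu * s) ^+ 2 * (1 - eps / 5) ^+ 2 by field.
by rewrite ler_wpM2l ?sqr_ge0 // ratio_le.
Qed.
End RankOnePerturbation.

(** * Distance from the adjacency matrix to the rank one matrix of the weights *)

Section RankOneApproximation.
Variables (R : realType) (n : nat) (loops : bool) (w : 'I_n -> R).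
Hypothesis n_gt0 : (0 < n)%N.
Hypothesis w_gt0 : forall i, 0 < w i.
Hypothesis wmax_le : wmax w <= Num.sqrt (wsum w).

Let S_gt0 : 0 < wsum w := wsum_gt0 w_gt0 (Ordinal n_gt0).

Lemma adj_graph_of_sym g : (adj R (@graph_of n g))^T = adj R (graph_of g).
Proof. by apply/matrixP => a b; rewrite !mxE !ffunE /= edgeC. Qed.

Lemma sqr_norm2_vec : norm2 (vec w) ^+ 2 = \sum_i w i ^+ 2.
Proof. by rewrite sqr_norm2 dotvE; apply: eq_bigr => i _; rewrite !mxE. Qed.

Lemma norm2_vec_gt0 : 0 < norm2 (vec w).
Proof.
rewrite lt_neqAle norm2_ge0 andbT eq_sym; apply/eqP => /norm2_eq0 /colP /(_ (Ordinal n_gt0)).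
by rewrite !mxE => w0; have := w_gt0 (Ordinal n_gt0); rewrite w0 ltxx.
Qed.

Lemma dtilde_gt0 : 0 < dtilde w.
Proof. by rewrite /dtilde -sqr_norm2_vec divr_gt0 // exprn_gt0 ?norm2_vec_gt0. Qed.

Lemma dtilde_le_wmax : dtilde w <= wmax w.
Proof.
rewrite /dtilde ler_pdivrMr // /wsum big_distrr; apply: ler_sum => i _ /=.
by rewrite expr2 ler_wpM2r ?le_wmax // ltW.
Qed.

Lemma adj_near_rank_one g (B : R) m (v := (norm2 (vec w))^-1 *: vec w) : 0 <= B ->
  \tr (noise_mx loops w g ^+ m.+1.*2) <= B ^+ m.+1 ->
  forall x, `|dotv x (adj R (graph_of g) *m x) - dtilde w * dotv v x ^+ 2|
    <= (Num.sqrt B + 1) * dotv x x.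
Proof.
move=> B0 trB x; set X := noise_mx loops w g in trB.
have Xsym : X^T = X by exact: bern_series_sym (@edge_mx_sym R n) g.
have := quadform_le_mxtrace x Xsym B0 trB.
(* The diagonal lost when self-loops are removed; its entries lie in [0, 1] and cost the [+ 1] in
   the bound. *)
pose d i := if loops then 0 else w i ^+ 2 / wsum w.
have d01 i : 0 <= d i <= 1.
  rewrite /d; case: loops; first by rewrite lexx ler01.
  rewrite divr_ge0 ?sqr_ge0 ?(ltW S_gt0) //= ler_pdivrMr // mul1r expr2.
  exact: mul_le_wsum.
have -> : adj R (graph_of g) =
    X + (wsum w)^-1 *: (vec w *m (vec w)^T) - diag_mx (\row_i d i).
  apply/matrixP => a b; rewrite !mxE big_ord1 noise_mxE !mxE /Abar /d.
  case: (eqVneq a b) => [->|_]; case: loops => /=; rewrite ?mulr0n ?mulr1n; field;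
    exact: lt0r_neq0.
rewrite mulmxBl mulmxDl dotvBr dotvDr -scalemxAl dotvZr -mulmxA.
have -> : dotv x (vec w *m ((vec w)^T *m x)) = dotv (vec w) x ^+ 2.
  by rewrite {1}/dotv mulmxA mxE big_ord1 -/(dotv _ _) -/(dotv _ _) dotvC.
have -> : dtilde w * dotv v x ^+ 2 = (wsum w)^-1 * dotv (vec w) x ^+ 2.
  rewrite [dotv v x]dotvC dotvZr dotvC exprMn /dtilde -sqr_norm2_vec; field.
  by rewrite !lt0r_neq0 ?norm2_vec_gt0.
have -> : dotv x (diag_mx (\row_i d i) *m x) = \sum_i d i * (x i 0 * x i 0).
  by rewrite dotvE; apply: eq_bigr => i _; rewrite mul_diag_mx !mxE; ring.
have D0 : 0 <= \sum_i d i * (x i 0 * x i 0).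
  by apply: sumr_ge0 => i _; have /andP[? _] := d01 i; rewrite mulr_ge0 // -expr2 sqr_ge0.
have D1 : \sum_i d i * (x i 0 * x i 0) <= dotv x x.
  rewrite dotvE; apply: ler_sum => i _; have /andP[_ ?] := d01 i.
  by rewrite -[leRHS]mul1r ler_wpM2r // -expr2 sqr_ge0.
move: D0 D1; set D := \sum_i _; set q := _^-1 * _; set e := dotv x (X *m x) => D0 D1.
have -> : e + q - D - q = e - D by ring.
rewrite !ler_norml mulrDl mul1r => /andP[? ?]; apply/andP; split; lra.
Qed.
End RankOneApproximation.

(** * Choice of the moment order and of the trace threshold *)

Theorem mainTheorem10 (R : realType) (n : nat) (loops : bool)
    (w : 'I_n -> R) (eps delta beta C : R) (b : 'I_n -> R) :
  (0 < n)%N ->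
  (forall i j : 'I_n, (i <= j)%N -> w j <= w i) ->
  (forall i, 0 < w i) ->
  wmax w <= Num.sqrt (wsum w) ->
  0 < eps < 1 -> 0 < delta < 1 ->
  concentration w eps delta ->
  0 < beta ->
  (forall i, 0 <= b i) ->
  C >= 256 * norm2 (vec b) ^+ 2 / (eps * beta * dtilde w) ^+ 2 ->
  Gw_prob loops w (fun A =>
     spectral_radius_lt A beta^-1 ->
     forall ystar, optimal_intervention beta A (vec b) C ystar ->
       (1 - eps) * welfare beta A (vec b) ystar
         <= welfare beta A (vec b) (Num.sqrt C *: ((norm2 (vec w))^-1 *: vec w)))
  >= 1 - delta.
Proof.
move=> n0 _ w0 wS eps01 /andP[del0 del1] [WL [_ tL]] beta0 _ Cb.
have /andP[eps0 eps1] := eps01.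
set t := dtilde w in tL Cb *; set W := wmax w in WL tL; set L := ln _ in WL tL.
have t0 : 0 < t := dtilde_gt0 n0 w0.
have tW : t <= W := dtilde_le_wmax n0 w0.
(* Used twice: for [1/2 <= L], and for [expR 1 <= 4] in the failure probability. *)
have e_half : expR 2^-1 <= 2 :> R.
  by apply: le_trans (expR_le1D2x _) _; lra.
have n1 : 1 <= n%:R :> R by rewrite ler1n.
have x2 : 2 <= 2 * n%:R / delta by rewrite ler_pdivlMr //; nra.
have expL : expR L = 2 * n%:R / delta by rewrite lnK // posrE; lra.
have L_ge : 2^-1 <= L by rewrite -ler_expR expL; lra.
set s := Num.sqrt (4 * W * L) in tL.
have s0 : 0 <= s by exact: sqrtr_ge0.
have eps2 : 0 < eps ^+ 2 by rewrite exprn_gt0.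
have t_ge : 256 * (s + 1) <= t * eps ^+ 2 by rewrite -ler_pdivrMr.
have W_ge : 256 <= W.
  apply: le_trans tW; have : t * eps ^+ 2 <= t by rewrite ler_piMr ?(ltW t0) //; nra.
  by lra.
(* The order [m.+1] lies in [(L, L + 1]]: above [L] for the probability, and below [3 * W] because
   [L <= 9/4 * W] and [W >= 256]. *)
pose m := Num.truncn L.
have /andP[mL Lm] : m%:R <= L < m.+1%:R by apply: Num.Theory.truncn_itv; lra.
have m_le : m.+1%:R <= 3 * W by rewrite -natr1; lra.
pose B := 24 * m.+1%:R * W.
have B0 : 0 <= B by rewrite /B; have : 0 <= m.+1%:R :> R by []; nra.
have B_le : Num.sqrt B + 1 <= eps * t / 50.
  (* From [1/2 <= L] comes [m.+1 <= 3 * L], so [B <= 72 * W * L], whereas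
     [(5 * s) ^+ 2 = 100 * W * L]. *)
  have : Num.sqrt B <= 5 * s.
    rewrite -[leRHS]ger0_norm ?mulr_ge0 // -sqrtr_sqr ler_wsqrtr // exprMn sqr_sqrtr.
      by rewrite /B -natr1; nra.
    by nra.
  have : eps * (eps * t) <= eps * t by rewrite ler_piMl ?(ltW eps1) // mulr_ge0 ?ltW.
  by move: t_ge; rewrite expr2; lra.
rewrite Gw_prob_expect.
(* The failure probability is at most [delta], since [n / delta <= expR L <= expR m.+1 <= 4 ^+
   m.+1]. *)
apply: (@le_trans _ _ (1 - n%:R / 4 ^+ m.+1)).
  rewrite lerD2l lerN2 ler_pdivrMr ?exprn_gt0 // mulrC -ler_pdivrMr //.
  apply: (@le_trans _ _ (expR L)); first by rewrite expL ler_pM2r ?invr_gt0 //; lra.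
  apply: (@le_trans _ _ (expR m.+1%:R)); first by rewrite ler_expR ltW.
  rewrite -[m.+1%:R]mulr1 expRM_natl lerXn2r ?nnegrE ?expR_ge0 //.
  have -> : 1 = 2^-1 + 2^-1 :> R by lra.
  by rewrite expRD; have := expR_ge0 (2^-1 : R); nra.
apply: le_trans (noise_tail loops w0 wS m_le) _.
(* The indicators are compared graph by graph: the trace bound implies the welfare guarantee
   deterministically. *)
apply: (ler_bern_expect (edge_prob01 loops w0 wS)) => g.
rewrite ler_nat; case: (ltP (\tr _)) => // /ltW trB.
case: asboolP => // -[] rho ystar [ystarC _].
have near := adj_near_rank_one n0 w0 wS B0 trB.
have v1 : norm2 ((norm2 (vec w))^-1 *: vec w) = 1.
  have nw := norm2_vec_gt0 n0 w0.
  by rewrite norm2Z ger0_norm ?invr_ge0 ?(ltW nw) // mulVf // lt0r_neq0.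
exact: (welfare_rank_one n0 (@adj_graph_of_sym R n g) v1 near t0 B_le).
Qed.
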